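(* Let $r\ge1$. Let $\overline{A}(\ell_1,\dots,\ell_r;k,n)$ be the number of overpartitions of $n$ into non-negative parts, each coloured by one of the primary colours $u_1,\dots,u_r$, having exactly $\ell_i$ parts coloured $u_i$ for each $i$ and exactly $k$ non-overlined parts. Let $\overline{B}(\ell_1,\dots,\ell_r;k,n)$ be the number of finite sequences $\lambda_1,\dots,\lambda_s$ of non-negative integers, each coloured by one of $\tilde u_1,\dots,\tilde u_{2^r-1}$ and each possibly overlined, with $\sum\lambda_i=n$, such that for each $i\in\{1,\dots,r\}$ exactly $\ell_i$ parts have $u_i$ among their primary colours, exactly $k$ parts are non-overlined, and for all $1\le i<s$ $$\lambda_i-\lambda_{i+1}\ge w(c(\lambda_{i+1}))+\chi(\overline{\lambda_{i+1}})-1+\delta(c(\lambda_i),c(\lambda_{i+1})),$$ where $c(\lambda)$ is the colour of $\lambda$ and $\chi(\overline{\lambda_{i+1}})=1$ if $\lambda_{i+1}$ is overlined and $0$ otherwise. Then $\overline{A}(\ell_1,\dots,\ell_r;k,n)=\overline{B}(\ell_1,\dots,\ell_r;k,n)$ for all $\ell_1,\dots,\ell_r,k,n\ge0$.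
   Context: An overpartition with coloured parts is a finite multiset of coloured non-negative integers, some of which are overlined, such that for each colour and each integer value at most one part of that colour and value is overlined (non-overlined parts may repeat). Primary colours $u_1<\dots<u_r$. For $i\in\{1,\dots,2^r-1\}$, $\tilde u_i:=u_1^{\epsilon_1(i)}\cdots u_r^{\epsilon_r(i)}$ where $\epsilon_k(i)=1$ if $2^{k-1}$ appears in the binary expansion of $i$ and $0$ otherwise; ''$u_j$ is a primary colour of $\tilde u_i$'' means $\epsilon_j(i)=1$. For a colour $\tilde u_i$: $v(\tilde u_i)$ (resp. $z(\tilde u_i)$) is the smallest (resp. largest) primary colour appearing in $\tilde u_i$, and $w(\tilde u_i)$ is the number of primary colours appearing in it. $\delta(\tilde u_i,\tilde u_j)=1$ if $z(\tilde u_i)<v(\tilde u_j)$ (in the order $u_1<\dots<u_r$), and $0$ otherwise. *)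

(* Defs.v *)
From HB Require Import structures.
From mathcomp Require Import all_boot all_order all_algebra.
Set Implicit Arguments. Unset Strict Implicit. Unset Printing Implicit Defensive.
Import Order.TTheory GRing.Theory Num.Theory.

(* Primary colours u_1 < ... < u_r are encoded as j : 'I_r (u_{j+1} <-> j).
   Composite colours tilde u_c, 1 <= c <= 2^r - 1, are encoded by the index c;
   u_{j+1} is a primary colour of tilde u_c iff bit j of c is 1. *)

(* a potential part: (value, primary colour, overlined?) ; values of a part of
   an overpartition of n are at most n *)
Definition Apart (r n : nat) := ('I_n.+1 * 'I_r * bool)%type.

(* an overpartition is a multiset of parts, given by its multiplicity function;
   multiplicities are bounded by L = total number of parts *)
Definition A_ok (r n L : nat) (l : 'I_r -> nat) (k : nat)
    (m : {ffun Apart r n -> 'I_L.+1}) : bool :=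
  [&& [forall p : Apart r n, p.2 ==> (m p <= 1)%N],
      (\sum_(p : Apart r n) m p * p.1.1)%N == n,
      [forall i : 'I_r, (\sum_(p : Apart r n | p.1.2 == i) m p)%N == l i] &
      (\sum_(p : Apart r n | ~~ p.2) m p)%N == k].

Definition Abar (r : nat) (l : 'I_r -> nat) (k n : nat) : nat :=
  #|[set m : {ffun Apart r n -> 'I_(\sum_(i < r) l i).+1}
       | @A_ok r n _ l k m]|.

Definition prim (r c : nat) : {set 'I_r} := [set j : 'I_r | odd (c %/ 2 ^ j)].
Definition wcol (r c : nat) : nat := #|prim r c|.
Definition vcol (r c : nat) : nat := \big[minn/r]_(j in prim r c) (j : nat).
Definition zcol (r c : nat) : nat := \max_(j in prim r c) (j : nat).
Definition deltac (r c d : nat) : nat := (zcol r c < vcol r d)%N.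
Definition chi (b : bool) : nat := b.

(* a part: (value, colour index c in [1, 2^r - 1], overlined?) *)
Definition Bpart (r n : nat) := ('I_n.+1 * 'I_(2 ^ r) * bool)%type.

Definition Bdiff (r n : nat) (p q : Bpart r n) : bool :=
  ((p.1.1 : nat)%:Z - (q.1.1 : nat)%:Z >=
     (wcol r q.1.2)%:Z + (chi q.2)%:Z - 1 + (deltac r p.1.2 q.1.2)%:Z)%R.

Definition B_ok (r n : nat) (l : 'I_r -> nat) (k : nat) (s : seq (Bpart r n)) : bool :=
  [&& all (fun p : Bpart r n => 0 < p.1.2)%N s,
      (\sum_(p <- s) p.1.1)%N == n,
      [forall i : 'I_r, count (fun p : Bpart r n => i \in prim r p.1.2) s == l i],
      count (fun p : Bpart r n => ~~ p.2) s == k &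
      sorted (@Bdiff r n) s].

(* sequences of length s; each part carries at least one primary colour, so
   s <= \sum_i l_i *)
Definition Bbar (r : nat) (l : 'I_r -> nat) (k n : nat) : nat :=
  (\sum_(s < (\sum_(i < r) l i).+1)
     #|[set t : s.-tuple (Bpart r n) | @B_ok r n l k t]|)%N.

(* Main.v *)
Require Import Defs.
From mathcomp Require Import all_boot all_order all_algebra zify.
Set Implicit Arguments. Unset Strict Implicit. Unset Printing Implicit Defensive.
Import Order.TTheory GRing.Theory Num.Theory.
Local Open Scope ring_scope.

(* Write [A] for the generating function of the overpartitions, where [d] marks
   non-overlined parts and [q] the size. It is determined by two facts: no
   overpartition survives at [d = -1] except the empty one, and
   [(1 - d u_1) ... (1 - d u_r) A(d) = A(q d)], because the left-hand side counts
   the overpartitions without non-overlined zeros. The factors are applied one at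
   a time, so that the second fact becomes a chain of subtraction-free recurrences
   between intermediate families [f 0 = A, f 1, ..., f r = A(q d)].

   For the sequences counted by [B], toggling the overline of the first part gives
   the first fact. A sequence with colour word [w] is an overpartition with
   [size w] parts on top of the minimal sequence coloured by [w]. For a fixed word,
   the sequences not ending in a non-overlined zero are equinumerous with those in
   which [d] is replaced by [q d]. The intermediate family [f j] counts the
   sequences to which a non-overlined zero of colour [M u_j], with all colours of
   [M] smaller than [u_j], can be appended: passing from [u_j] to [u_(j+1)] loses
   exactly the sequences that end in a non-overlined zero with largest colour
   [u_j]. Those ending in an overlined such zero are also lost when [M] is empty,
   but are recovered as the sets [M] containing [u_j]. *)

(** * Uniqueness *)

Definition drop_colour (r : nat) (l : 'I_r -> int) (j : 'I_r) : 'I_r -> int :=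
  fun i => l i - (i == j)%:Z.

(** Coefficient form of the functional equations: [zp_step] reads [(1 - d u_j) f_j = f_(j+1)],
    [zp_last] reads [f_r(d) = f_0(q d)], and [zp_alt] evaluates [f_0] at [d = -1]. Integer indices
    let shifted coefficients vanish instead of truncating; [L] and [N] delimit the range where
    finite encodings are faithful. *)
Record zero_peeling (r L : nat) (N : int)
    (f : nat -> ('I_r -> int) -> int -> int -> int) : Prop := ZeroPeeling {
  zp_l0 : forall j l k n i, l i < 0 -> f j l k n = 0;
  zp_k0 : forall l k n, k < 0 -> f 0%N l k n = 0;
  zp_n0 : forall l k n, n < 0 -> f 0%N l k n = 0;
  zp_step : forall (j : 'I_r) l k n, \sum_i l i <= L%:Z -> n <= N ->
    f j l k n = f j.+1 l k n + f j (drop_colour l j) (k - 1) n;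
  zp_last : forall l k n, \sum_i l i <= L%:Z -> n <= N ->
    f r l k n = f 0%N l k (n - k);
  zp_alt : forall l n, \sum_i l i <= L%:Z -> n <= N ->
    \sum_(k < L.+1) (-1) ^+ k * f 0%N l k%:Z n
      = ((n == 0) && [forall i, l i == 0])%:Z }.

Lemma sum_drop_colour (r : nat) (l : 'I_r -> int) (j : 'I_r) :
  \sum_i drop_colour l j i = \sum_i l i - 1.
Proof.
rewrite /drop_colour sumrB; congr (_ - _).
rewrite (bigD1 j) //= eqxx big1 ?addr0 // => i /negbTE ->; by [].
Qed.

Lemma sum_lt0_ex (r : nat) (l : 'I_r -> int) :
  \sum_i l i < 0 -> exists i, l i < 0.
Proof.
move=> h; apply/existsP; apply: contraLR h => /existsPn h.
by rewrite -leNgt sumr_ge0 // => i _; rewrite leNgt h.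
Qed.

Lemma peel_telescope (r : nat) (f : nat -> ('I_r -> int) -> int -> int -> int) l k n :
  (forall j : 'I_r, f j l k n = f j.+1 l k n + f j (drop_colour l j) (k - 1) n) ->
  f 0%N l k n = f r l k n + \sum_(j < r) f j (drop_colour l j) (k - 1) n.
Proof.
move=> step.
have -> : \sum_(j < r) f j (drop_colour l j) (k - 1) n
  = \sum_(j < r) (f j l k n - f j.+1 l k n).
  by apply: eq_bigr => j _; have := step j; lia.
rewrite -(big_mkord xpredT (fun j => f j l k n - f j.+1 l k n)).
rewrite (eq_bigr (fun j => - (f j.+1 l k n - f j l k n))); last first.
  by move=> j _; rewrite opprB.
by rewrite sumrN telescope_sumr // opprB addrC subrK.
Qed.

(** Induction on the total of [l]. With smaller totals known, telescoping the steps and [zp_last]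
    express the coefficient at [n] by the one at [n - k], which settles [k > 0] by induction on [n].
    For [k = 0] that relation is vacuous, and [zp_alt] recovers the coefficient from those with
    [k > 0]. *)
Theorem zero_peeling_unique (r L : nat) (N : int) f g (l : 'I_r -> int) k n :
  zero_peeling L N f -> zero_peeling L N g ->
  \sum_i l i <= L%:Z -> n <= N -> f 0%N l k n = g 0%N l k n.
Proof.
move=> zf zg hl hn.
suff H m : (m <= L.+1)%N -> forall l, \sum_i l i < m%:Z -> forall j, (j <= r)%N ->
    forall k n, n <= N -> f j l k n = g j l k n.
  by apply: (H L.+1) => //; rewrite intS addrC ltzD1.
move=> {l k n hl hn}.
elim: m => [_ l /sum_lt0_ex[i li] j _ k n _ | m IHm hm l hl].
  by rewrite (zp_l0 zf _ _ _ li) (zp_l0 zg _ _ _ li).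
have {}IHm : forall j : 'I_r, forall j', (j' <= r)%N -> forall k n, n <= N ->
    f j' (drop_colour l j) k n = g j' (drop_colour l j) k n.
  by move=> j; apply: IHm; [lia | rewrite sum_drop_colour ltrBlDr addrC -intS].
have hL : \sum_i l i <= L%:Z.
  by rewrite -ltzD1 (lt_le_trans hl) // -PoszD lez_nat addn1.
have Hk n k : 0 < k -> n <= N -> f 0%N l k n = g 0%N l k n.
  move=> k0.
  have [q] : exists q : nat, n < q%:Z by exists `|n|.+1; lia.
  elim: q n => [|q IHq] n nq hn; first by rewrite (zp_n0 zf) // (zp_n0 zg).
  rewrite (peel_telescope (fun j => zp_step zf j k hL hn)).
  rewrite (peel_telescope (fun j => zp_step zg j k hL hn)).
  rewrite (zp_last zf) // (zp_last zg) // IHq; [|lia|lia].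
  by congr (_ + _); apply: eq_bigr => j _; rewrite IHm // ltnW.
have H0 n : n <= N -> f 0%N l 0 n = g 0%N l 0 n.
  move=> hn; have := zp_alt zf hL hn; rewrite -(zp_alt zg hL hn).
  rewrite !big_ord_recl !expr0 !mul1r => e.
  apply: (addIr (\sum_(i < L) (-1) ^+ lift ord0 i * f 0%N l (lift ord0 i)%:Z n)).
  rewrite e; congr (_ + _); apply: eq_bigr => i _; rewrite Hk //.
(* The later families follow from [f 0] by solving [zp_step] for [f j.+1]. *)
elim=> [|j IHj] jr k n hn.
  case: (ltgtP k 0) => [k0|k0|->]; [|exact: Hk|exact: H0].
  by rewrite (zp_k0 zf) // (zp_k0 zg).
have := zp_step zf (Ordinal jr) k hL hn; have := zp_step zg (Ordinal jr) k hL hn.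
rewrite /= IHj ?(ltnW jr) // IHm ?(ltnW jr) // => -> e.
by apply: (addIr (g j (drop_colour l (Ordinal jr)) (k - 1) n)).
Qed.

(** * Coloured overpartitions *)

Lemma card_in_bij (T U : finType) (A : {set T}) (B : {set U}) f g :
  {in A, forall x, f x \in B} -> {in B, forall y, g y \in A} ->
  {in A, cancel f g} -> {in B, cancel g f} -> #|A| = #|B|.
Proof.
move=> fB gA fK gK; rewrite -(card_in_imset (can_in_inj fK)).
apply: eq_card => y; apply/imsetP/idP => [[x xA ->]|yB]; first exact: fB.
by exists (g y); rewrite ?gK ?gA.
Qed.

Lemma sum_sign_reversing (T : finType) (D : pred T) (s : T -> int) (f : T -> T) :
  (forall x, D x -> [/\ D (f x), f (f x) = x & s (f x) = - s x]) ->
  \sum_(x | D x) s x = 0.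
Proof.
move=> H; suff : \sum_(x | D x) s x = - \sum_(x | D x) s x by lia.
rewrite -sumrN (reindex_onto f f) => [|x /H[]//].
apply: eq_big => [x|x /andP[/H[Dx _ _] /eqP ffx]].
  apply/andP/idP => [[/H[Dx _ _] /eqP <-]//|/H[-> -> _]]; by rewrite eqxx.
by rewrite ffx in Dx; case: (H x Dx).
Qed.

Definition msum (T : finType) (L : nat) (m : {ffun T -> 'I_L.+1}) (F : T -> nat) :=
  (\sum_p m p * F p)%N.

(** Out of range, [inord] would reset the multiplicity to 0; hence the bounds [v <= L] below. *)
Definition mset (T : finType) (L : nat) (m : {ffun T -> 'I_L.+1}) (p : T) (v : nat) :
  {ffun T -> 'I_L.+1} := [ffun x => if x == p then inord v else m x].

Lemma msetE (T : finType) (L : nat) (m : {ffun T -> 'I_L.+1}) p v x :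
  (v <= L)%N -> mset m p v x = (if x == p then v else m x) :> nat.
Proof. by move=> vL; rewrite ffunE; case: ifP => // _; rewrite inordK. Qed.

Lemma mset_mset (T : finType) (L : nat) (m : {ffun T -> 'I_L.+1}) p v w :
  mset (mset m p v) p w = mset m p w.
Proof. by apply/ffunP => x; rewrite !ffunE; case: eqP. Qed.

Lemma mset_id (T : finType) (L : nat) (m : {ffun T -> 'I_L.+1}) p :
  mset m p (m p) = m.
Proof. by apply/ffunP => x; rewrite ffunE; case: eqP => // ->; rewrite inord_val. Qed.

Lemma msum_mset (T : finType) (L : nat) (m : {ffun T -> 'I_L.+1}) p v F :
  (v <= L)%N -> (msum (mset m p v) F + m p * F p = msum m F + v * F p)%N.
Proof.
move=> vL; rewrite /msum (bigD1 p) // [in RHS](bigD1 p) //= msetE // eqxx.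
under eq_bigr => i /negbTE ip do rewrite msetE // ip.
by rewrite addnC addnCA addnA addnC addnA addnC [in RHS]addnAC -!addnA; congr addn; rewrite addnC.
Qed.

Lemma msum_incr (T : finType) (L : nat) (m : {ffun T -> 'I_L.+1}) p F :
  (m p < L)%N -> msum (mset m p (m p).+1) F = (msum m F + F p)%N.
Proof. by move=> h; have := msum_mset m p F h; rewrite mulSn; lia. Qed.

Lemma msum_decr (T : finType) (L : nat) (m : {ffun T -> 'I_L.+1}) p F :
  (0 < m p)%N -> (msum (mset m p (m p).-1) F + F p)%N = msum m F.
Proof.
move=> h; have b : ((m p).-1 <= L)%N by have := ltn_ord (m p); lia.
by have := msum_mset m p F b; rewrite -{2}(prednK h) mulSn; lia.
Qed.

Lemma leq_msum (T : finType) (L : nat) (m : {ffun T -> 'I_L.+1}) p F :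
  (m p * F p <= msum m F)%N.
Proof. by rewrite /msum (bigD1 p) //= leq_addr. Qed.

Definition A_mset (r N L : nat) (l : 'I_r -> int) (n : int)
    (m : {ffun Apart r N -> 'I_L.+1}) : bool :=
  [&& [forall p : Apart r N, p.2 ==> (m p <= 1)%N],
      (msum m (fun p => p.1.1))%:Z == n &
      [forall i : 'I_r, (msum m (fun p => p.1.2 == i))%:Z == l i]].

Definition nonover (r N L : nat) (m : {ffun Apart r N -> 'I_L.+1}) : nat :=
  msum m (fun p => ~~ p.2).

(** Forbidding non-overlined zeros of the first [j] colours multiplies the generating function by
    [1 - d u_i] for each of these colours. *)
Definition A_set (r N L j : nat) (l : 'I_r -> int) (k n : int) :=
  [set m : {ffun Apart r N -> 'I_L.+1} |
    [&& A_mset l n m, (nonover m)%:Z == k &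
        [forall i : 'I_r, (i < j)%N ==> (m (ord0, i, false) == ord0)]]].

Definition A_family (r N L j : nat) (l : 'I_r -> int) (k n : int) : int :=
  #|A_set N L j l k n|%:Z.

(** Each part has exactly one primary colour. This bounds every multiplicity by the total of [l], so
    the cap [L] cuts nothing off. *)
Lemma A_mset_total (r N L : nat) (l : 'I_r -> int) n
    (m : {ffun Apart r N -> 'I_L.+1}) :
  A_mset l n m -> (msum m (fun=> 1%N))%:Z = \sum_i l i.
Proof.
case/and3P => _ _ /forallP h.
rewrite -(eq_bigr _ (fun i _ => eqP (h i))) /msum.
rewrite -(big_morph _ PoszD (erefl _)) exchange_big /=; congr Posz.
apply: eq_bigr => p _; rewrite -big_distrr /= (bigD1 p.1.2) //= eqxx.
by rewrite big1 ?addn0 // => i /negbTE ip; rewrite eq_sym ip.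
Qed.

Lemma A_mset_le_total (r N L : nat) (l : 'I_r -> int) n
    (m : {ffun Apart r N -> 'I_L.+1}) p :
  A_mset l n m -> (m p)%:Z <= \sum_i l i.
Proof.
by move=> /A_mset_total <-; have := leq_msum m p (fun=> 1%N); rewrite muln1 lez_nat.
Qed.

(** What [j] counts and [j.+1] does not contains a non-overlined zero of colour [u_j]. Removing one
    copy is reversible, since the total left is below [L]. *)
Lemma A_family_step (r N L : nat) (j : 'I_r) (l : 'I_r -> int) k n :
  \sum_i l i <= L%:Z ->
  A_family N L j l k n = A_family N L j.+1 l k n
    + A_family N L j (drop_colour l j) (k - 1) n.
Proof.
move=> hl; rewrite /A_family -PoszD; congr Posz.
pose p0 : Apart r N := (ord0, j, false).
rewrite -(cardsID [set m : {ffun Apart r N -> 'I_L.+1} | m p0 == ord0]); congr addn.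
  apply: eq_card => m; rewrite !inE -!andbA; do 4!congr (_ && _).
  apply/andP/forallP => [[/forallP h1 h2] i|h].
    apply/implyP; rewrite ltnS leq_eqVlt => /orP[/eqP/val_inj -> //|].
    exact/implyP.
  split; last by apply: (implyP (h j)).
  by apply/forallP => i; apply/implyP => ij; apply: (implyP (h i)); apply: ltnW.
apply: (card_in_bij (f := fun m => mset m p0 (m p0).-1)
                    (g := fun m => mset m p0 (m p0).+1)) => m; rewrite !inE.
- case/andP=> m0 /and3P[/and3P[/forallP h1 /eqP h2 /forallP h3] /eqP h4 /forallP h5].
  have b : ((m p0).-1 <= L)%N by have := ltn_ord (m p0); lia.
  have m1 : (0 < m p0)%N by rewrite lt0n.
  apply/and3P; split; [apply/and3P; split| |].
  + apply/forallP => p; apply/implyP => pb; rewrite msetE //.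
    by case: eqP => [e|_]; [rewrite e in pb | apply: (implyP (h1 p))].
  + by rewrite -h2 -(msum_decr (fun p : Apart r N => p.1.1 : nat) m1) addn0.
  + apply/forallP => i; rewrite /drop_colour -(eqP (h3 i)).
    by rewrite -(msum_decr (fun p : Apart r N => p.1.2 == i : nat) m1) /= PoszD [i == j]eq_sym addrK.
  + by rewrite -h4 /nonover -(msum_decr (fun p : Apart r N => ~~ p.2 : nat) m1) PoszD addrK.
  + apply/forallP => i; apply/implyP => ij; rewrite -val_eqE /= msetE //.
    case: (_ =P p0) => [[e]|_]; last by have := implyP (h5 i) ij; rewrite -val_eqE.
    by rewrite e ltnn in ij.
- case/and3P=> /[dup] hm /and3P[/forallP h1 /eqP h2 /forallP h3] /eqP h4 /forallP h5.
  have b : ((m p0).+1 <= L)%N.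
    have := A_mset_le_total p0 hm; rewrite sum_drop_colour lerBrDr.
    by move/le_trans/(_ hl); rewrite -PoszD addn1 lez_nat.
  apply/andP; split; first by rewrite -val_eqE /= msetE // eqxx.
  apply/and3P; split; [apply/and3P; split| |].
  + apply/forallP => p; apply/implyP => pb; rewrite msetE //.
    by case: eqP => [e|_]; [rewrite e in pb | apply: (implyP (h1 p))].
  + by rewrite -h2 (msum_incr _ b) addn0.
  + apply/forallP => i; rewrite (msum_incr _ b) PoszD (eqP (h3 i)).
    by rewrite /drop_colour [i == j]eq_sym subrK.
  + by rewrite /nonover (msum_incr _ b) PoszD [Posz (msum _ _)]h4 subrK.
  + apply/forallP => i; apply/implyP => ij; rewrite -val_eqE /= msetE //.
    case: (_ =P p0) => [[e]|_]; last by have := implyP (h5 i) ij; rewrite -val_eqE.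
    by rewrite e ltnn in ij.
- case/andP=> m0 _; have m1 : (0 < m p0)%N by rewrite lt0n.
  rewrite mset_mset msetE ?eqxx ?prednK ?mset_id //.
  by rewrite (leq_trans (leq_pred _)) // -ltnS.
- case/and3P=> hm _ _.
  have b : ((m p0).+1 <= L)%N.
    have := A_mset_le_total p0 hm; rewrite sum_drop_colour lerBrDr.
    by move/le_trans/(_ hl); rewrite -PoszD addn1 lez_nat.
  by rewrite mset_mset msetE ?eqxx ?mset_id.
Qed.

(* Values are rotated modulo [N + 1], so that raising the non-overlined parts
   is a permutation of [Apart r N]; no part of value [N] ever wraps around. *)
Definition raise (r N : nat) (p : Apart r N) : Apart r N :=
  if p.2 then p else (ordS p.1.1, p.1.2, false).

Definition lower (r N : nat) (p : Apart r N) : Apart r N :=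
  if p.2 then p else (ord_pred p.1.1, p.1.2, false).

Lemma raiseK (r N : nat) : cancel (@raise r N) (@lower r N).
Proof. by move=> [[v i] []] //=; rewrite /raise /lower /= ordSK. Qed.

Lemma lowerK (r N : nat) : cancel (@lower r N) (@raise r N).
Proof. by move=> [[v i] []] //=; rewrite /raise /lower /= ord_predK. Qed.

Definition mcomp (T : finType) (L : nat) (m : {ffun T -> 'I_L.+1}) (f : T -> T) :
  {ffun T -> 'I_L.+1} := [ffun p => m (f p)].

Lemma msum_mcomp (T : finType) (L : nat) (m : {ffun T -> 'I_L.+1}) f g F :
  cancel f g -> cancel g f -> msum (mcomp m f) F = msum m (F \o g).
Proof.
move=> fK gK; rewrite /msum (reindex_inj (can_inj gK)).
by apply: eq_bigr => p _; rewrite ffunE gK.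
Qed.

Lemma mcompK (T : finType) (L : nat) f g :
  cancel g f -> cancel (fun m : {ffun T -> 'I_L.+1} => mcomp m f) (fun m => mcomp m g).
Proof. by move=> gK m; apply/ffunP => p; rewrite !ffunE gK. Qed.

Lemma A_family_last (r N L : nat) (l : 'I_r -> int) k n :
  n <= N%:Z -> A_family N L r l k n = A_family N L 0 l k (n - k).
Proof.
move=> hn; rewrite /A_family; congr Posz.
have col f (m : {ffun Apart r N -> 'I_L.+1}) i :
    f = @raise r N \/ f = @lower r N ->
    msum m ((fun p => (p.1.2 == i) : nat) \o f) = msum m (fun p => p.1.2 == i).
  move=> hf; apply: eq_bigr => -[[v c] b] _ /=; congr (_ * _)%N.
  by case: hf => ->; rewrite /raise /lower /=; case: b.
have non f (m : {ffun Apart r N -> 'I_L.+1}) :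
    f = @raise r N \/ f = @lower r N ->
    msum m ((fun p => (~~ p.2) : nat) \o f) = nonover m.
  move=> hf; apply: eq_bigr => -[[v c] b] _ /=; congr (_ * _)%N.
  by case: hf => ->; rewrite /raise /lower /=; case: b.
have over f (m : {ffun Apart r N -> 'I_L.+1}) :
    f = @raise r N \/ f = @lower r N ->
    [forall p : Apart r N, p.2 ==> (m p <= 1)%N] ->
    [forall p : Apart r N, p.2 ==> (mcomp m f p <= 1)%N].
  move=> hf /forallP h; apply/forallP => -[[v c] b]; rewrite ffunE.
  by apply/implyP => /= bt; apply: (implyP (h _)); case: hf => ->; rewrite /raise /lower bt.
(* Composition with [raise] gives [p] the multiplicity of [raise p], so it lowers the non-overlined
   parts by one. *)
apply: (card_in_bij (f := fun m => mcomp m (@raise r N))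
                    (g := fun m => mcomp m (@lower r N))) => m; rewrite ?inE.
- case/and3P=> /and3P[h1 /eqP h2 /forallP h3] /eqP h4 /forallP h5.
  apply/and3P; split; last by apply/forallP.
    apply/and3P; split; first by apply: over => //; left.
      rewrite (msum_mcomp _ _ (@raiseK r N) (@lowerK r N)) -h2 -h4.
      rewrite eq_sym subr_eq -PoszD eqz_nat /nonover /msum -big_split.
      apply/eqP/eq_bigr => -[[v c] b] _ /=; rewrite -mulnDr.
      case: b => /=; first by rewrite addn0.
      rewrite /lower /=.
      have [v0|v0] := posnP v.
        have -> : v = ord0 by apply: val_inj.
        by have := h5 c; rewrite ltn_ord => /eqP ->; rewrite !mul0n.
      congr (_ * _)%N => /=; have -> : ((v + N.+1).-1 = v.-1 + N.+1)%N by lia.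
      by rewrite modnDr modn_small ?addn1 ?prednK //; have := ltn_ord v; lia.
    apply/forallP => i; rewrite (msum_mcomp _ _ (@raiseK r N) (@lowerK r N)).
    by rewrite col; [exact: h3 | right].
  rewrite /nonover (msum_mcomp _ _ (@raiseK r N) (@lowerK r N)) non; last by right.
  exact/eqP.
- case/and3P=> /and3P[h1 /eqP h2 /forallP h3] /eqP h4 _.
  (* A non-overlined part [N] would force [k >= 1] and [N <= n - k], against [n <= N]. *)
  have z c : m (ord_max, c, false) = ord0.
    apply/eqP; rewrite -val_eqE /=; apply: contraT; rewrite -lt0n => m0.
    have := leq_msum m (ord_max, c, false) (fun p => p.1.1).
    have := leq_msum m (ord_max, c, false) (fun p => ~~ p.2).
    rewrite /= muln1 -!lez_nat [Posz (msum _ _)]h4 [Posz (msum _ _)]h2.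
    by move: (m _) m0 => x; nia.
  apply/and3P; split.
  + apply/and3P; split; first by apply: over => //; right.
      rewrite (msum_mcomp _ _ (@lowerK r N) (@raiseK r N)).
      rewrite -(subrK k n) -h2 -h4 -PoszD eqz_nat /nonover /msum -big_split.
      apply/eqP/eq_bigr => -[[v c] b] _ /=; rewrite -mulnDr.
      case: b => /=; first by rewrite addn0.
      rewrite /raise /=.
      have [vN|vN] := eqVneq v ord_max; first by rewrite vN z !mul0n.
      congr (_ * _)%N; rewrite /= modn_small ?addn1 //.
      by move: vN; rewrite -val_eqE /=; have := ltn_ord v; lia.
    apply/forallP => i; rewrite (msum_mcomp _ _ (@lowerK r N) (@raiseK r N)).
    by rewrite col; [exact: h3 | left].
  + rewrite /nonover (msum_mcomp _ _ (@lowerK r N) (@raiseK r N)) non; last by left.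
    exact/eqP.
  + apply/forallP => i; apply/implyP => _; rewrite ffunE /lower /=.
    rewrite (_ : ord_pred ord0 = ord_max) ?z //.
    by apply: val_inj; rewrite /= modn_small.
- by move=> _; apply: mcompK; apply: lowerK.
- by move=> _; apply: mcompK; apply: raiseK.
Qed.

(** * Cancellation of overpartitions at [d = -1] *)

Definition mboth (r N L : nat) (m : {ffun Apart r N -> 'I_L.+1})
  (x : 'I_N.+1 * 'I_r) : nat := (m (x, false) + m (x, true))%N.

Lemma msum_both (r N L : nat) (m : {ffun Apart r N -> 'I_L.+1})
    (G : 'I_N.+1 * 'I_r -> nat) :
  msum m (fun p => G p.1) = (\sum_x mboth m x * G x)%N.
Proof.
rewrite /msum (eq_bigr (fun p => m (p.1, p.2) * G p.1)%N); last by case.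
rewrite -(pair_bigA _ (fun x b => m (x, b) * G x)%N) /=.
by apply: eq_bigr => x _; rewrite big_bool mulnDl addnC.
Qed.

(* The picked index depends only on [mboth m], which toggling preserves: this is
   why [mtoggle] is an involution. *)
Definition mtoggle (r N L : nat) (m : {ffun Apart r N -> 'I_L.+1}) :
    {ffun Apart r N -> 'I_L.+1} :=
  if [pick x | (0 < mboth m x)%N] is Some x then
    if m (x, true) == ord0
    then mset (mset m (x, true) 1) (x, false) (m (x, false)).-1
    else mset (mset m (x, true) 0) (x, false) (m (x, false)).+1
  else m.

Lemma mtoggleP (r N L : nat) (l : 'I_r -> int) n (m : {ffun Apart r N -> 'I_L.+1}) :
  \sum_i l i <= L%:Z -> A_mset l n m && (m != [ffun=> ord0]) ->
  [/\ A_mset l n (mtoggle m) && (mtoggle m != [ffun=> ord0]),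
      mtoggle (mtoggle m) = m &
      (-1) ^+ nonover (mtoggle m) = - (-1) ^+ nonover m :> int].
Proof.
move=> hl /andP[hm mn0].
have [x0 mx0] : exists x, (0 < mboth m x)%N.
  apply/existsP; apply: contraNT mn0 => /existsPn h.
  apply/eqP/ffunP => -[x b]; apply: val_inj; rewrite ffunE /=.
  by have := h x; rewrite -leqNgt leqn0 addn_eq0 => /andP[/eqP ? /eqP ?]; case: b.
pose tog x : {ffun Apart r N -> 'I_L.+1} := if m (x, true) == ord0
    then mset (mset m (x, true) 1) (x, false) (m (x, false)).-1
    else mset (mset m (x, true) 0) (x, false) (m (x, false)).+1.
(* Stated for every [m'] with the same [mboth], so that the same place [x] is picked before and
   after toggling. *)
have [x mx Ex] : exists2 x : 'I_N.+1 * 'I_r, (0 < mboth m x)%N &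
    forall m' : {ffun Apart r N -> 'I_L.+1}, mboth m' =1 mboth m -> [pick y | (0 < mboth m' y)%N] = Some x.
  case E: [pick y | (0 < mboth m y)%N] => [x|].
    exists x => [|m' e]; last by rewrite -E; apply: eq_pick => y; rewrite /= e.
    by move: E; case: pickP => // y ? [<-].
  by move: E; case: pickP => // /(_ x0); rewrite mx0.
have le1 : (m (x, true) <= 1)%N.
  by case/and3P: hm => /forallP/(_ (x, true)).
have leL : (mboth m x <= L)%N.
  rewrite -lez_nat (le_trans _ hl) // -(A_mset_total hm) lez_nat.
  rewrite (msum_both m (fun=> 1%N)) (bigD1 x) //= muln1; exact: leq_addr.
have mtE : mtoggle m = tog x by rewrite /mtoggle (Ex m).
have b1 : ((m (x, false)).-1 <= L)%N by move: leL; rewrite /mboth; lia.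
have b2 : m (x, true) != ord0 -> ((m (x, false)).+1 <= L)%N.
  by rewrite -val_eqE /=; move: leL; rewrite /mboth; lia.
have b3 : (1 <= L)%N := leq_trans mx leL.
have valf y : tog x (y, false) = (if y == x then
     (if m (x, true) == ord0 then (m (x, false)).-1 else (m (x, false)).+1)
     else m (y, false)) :> nat.
  rewrite /tog; case: (boolP (m (x, true) == ord0)) => [_|/b2 b2'].
    by rewrite msetE // xpair_eqE andbT; case: eqP => // _; rewrite msetE // xpair_eqE andbF.
  by rewrite msetE // xpair_eqE andbT; case: eqP => // _; rewrite msetE // xpair_eqE andbF.
have valt y : tog x (y, true) = (if y == x then (m (x, true) == ord0 : nat)
     else m (y, true)) :> nat.
  rewrite /tog; case: (boolP (m (x, true) == ord0)) => [_|/b2 b2'].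
    by rewrite msetE // xpair_eqE andbF msetE // xpair_eqE andbT.
  by rewrite msetE // xpair_eqE andbF msetE // xpair_eqE andbT.
have both : mboth (tog x) =1 mboth m.
  move=> y; rewrite /mboth valf valt; case: eqP => // ->.
  case: eqP => [e|/eqP]; first by move: mx; rewrite /mboth e /=; lia.
  by rewrite -val_eqE /=; lia.
have msumE (G : 'I_N.+1 * 'I_r -> nat) :
    msum (tog x) (fun p => G p.1) = msum m (fun p => G p.1).
  by rewrite !msum_both; apply: eq_bigr => y _; rewrite both.
rewrite mtE; split.
- apply/andP; split.
    case/and3P: hm => /forallP h1 h2 /forallP h3; apply/and3P; split.
    + apply/forallP => -[y b]; apply/implyP => /= bt; rewrite bt valt.
      by case: eqP => // _; [case: eqP | apply: (implyP (h1 (y, true)))].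
    + by rewrite (msumE (fun x => x.1)).
    + by apply/forallP => i; rewrite (msumE (fun x => x.2 == i)).
  apply: contraL mx => /eqP e; rewrite -both e /mboth !ffunE //.
- rewrite /mtoggle (Ex _ both).
  apply/ffunP => -[y b]; apply: val_inj.
  have t0 : (tog x (x, true) == ord0) = (m (x, true) != ord0).
    by rewrite -val_eqE /= valt eqxx; case: (m (x, true) == ord0).
  rewrite t0; case: (eqVneq (m (x, true)) ord0) => [e|e].
  + have m0 : (0 < m (x, false))%N by move: mx; rewrite /mboth e addn0.
    have f1 : tog x (x, false) = (m (x, false)).-1 :> nat by rewrite valf eqxx e eqxx.
    rewrite /= msetE; last by rewrite f1; have := ltn_ord (m (x, false)); lia.
    rewrite xpair_eqE; case: b => /=.
      rewrite andbF msetE // xpair_eqE andbT valt.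
      by case: eqP => // ->; rewrite e.
    rewrite andbT; case: eqP => [->|/eqP/negbTE yx]; first by rewrite f1 prednK.
    by rewrite msetE // xpair_eqE yx /= valf yx.
  + have f1 : tog x (x, false) = (m (x, false)).+1 :> nat by rewrite valf eqxx (negbTE e).
    rewrite /= msetE; last by rewrite f1 /=; have := ltn_ord (m (x, false)); lia.
    rewrite xpair_eqE; case: b => /=.
      rewrite andbF msetE // xpair_eqE andbT valt.
      by case: (y =P x) => // ->; apply/esym/eqP; rewrite eqn_leq le1 lt0n.
    rewrite andbT; case: eqP => [->|/eqP/negbTE yx]; first by rewrite f1.
    by rewrite msetE // xpair_eqE yx /= valf yx.
- have nE (m' : {ffun Apart r N -> 'I_L.+1}) : nonover m' = (\sum_y m' (y, false))%N.
    rewrite /nonover /msum (eq_bigr (fun p => m' (p.1, p.2) * ~~ p.2)%N); last by case.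
    rewrite -(pair_bigA _ (fun x b => m' (x, b) * ~~ b)%N) /=.
    by apply: eq_bigr => y _; rewrite big_bool /= muln0 muln1.
  have -> : nonover (tog x) = (tog x (x, false) + \sum_(y | y != x) m (y, false))%N.
    rewrite nE (bigD1 x) //=; congr addn; apply: eq_bigr => y /negbTE yx.
    by rewrite valf yx.
  rewrite (nE m) [in RHS](bigD1 x) //= !exprD -mulNr; congr (_ * _); rewrite valf eqxx.
  case: eqP => [e|e]; last by rewrite exprS mulN1r.
  have m0 : (0 < m (x, false))%N by move: mx; rewrite /mboth e addn0.
  by rewrite -{2}(prednK m0) exprS mulN1r opprK.
Qed.

Lemma A_family_alt (r N L : nat) (l : 'I_r -> int) n :
  \sum_i l i <= L%:Z ->
  \sum_(k < L.+1) (-1) ^+ k * A_family N L 0 l k%:Z n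
    = ((n == 0) && [forall i, l i == 0])%:Z.
Proof.
move=> hl.
transitivity (\sum_(m : {ffun Apart r N -> 'I_L.+1} | A_mset l n m)
    (-1) ^+ nonover m : int).
  (* Grouping by [nonover] is faithful: it is at most the total of [l], hence at most [L], so
     [inord] does not truncate. *)
  rewrite (partition_big (fun m => inord (nonover m) : 'I_L.+1) xpredT) //=.
  apply: eq_bigr => k _; rewrite /A_family -sum1_card.
  rewrite (big_morph _ PoszD (erefl _)) mulr_sumr.
  have nk m : A_mset l n m -> (inord (nonover m) == k :> 'I_L.+1) = (nonover m == k).
    move=> hm; rewrite -val_eqE /= inordK // ltnS -lez_nat (le_trans _ hl) //.
    rewrite -(A_mset_total hm) lez_nat; apply: leq_sum => p _.
    by rewrite leq_mul2l leq_b1 orbT.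
  apply: eq_big => [m|m].
    rewrite inE eqz_nat; case hm: (A_mset l n m) => //=; rewrite nk //.
    by rewrite andb_idr // => _; apply/forallP.
  by rewrite inE eqz_nat => /and3P[_ /eqP -> _]; rewrite mulr1.
rewrite (bigID (pred1 [ffun=> ord0])) /= [X in _ + X](_ : _ = 0) ?addr0; last first.
  exact: (@sum_sign_reversing _ _ _ _ (fun m => mtoggleP hl)).
have z F : msum ([ffun=> ord0] : {ffun Apart r N -> 'I_L.+1}) F = 0%N.
  by rewrite /msum big1 // => p _; rewrite ffunE mul0n.
rewrite big_mkcondl /= big_pred1_eq /nonover z expr0 /A_mset z eq_sym.
have -> : [forall p : Apart r N, p.2 ==>
    ((([ffun=> ord0] : {ffun Apart r N -> 'I_L.+1}) p : 'I_L.+1) <= 1)%N].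
  by apply/forallP => p; rewrite ffunE implybT.
have -> : [forall i, (msum ([ffun=> ord0] : {ffun Apart r N -> 'I_L.+1})
    (fun p => p.1.2 == i))%:Z == l i] = [forall i, l i == 0].
  by apply: eq_forallb => i; rewrite z eq_sym.
by rewrite /=; case: ifP.
Qed.

Lemma A_zero_peeling (r N L : nat) : zero_peeling L N%:Z (@A_family r N L).
Proof.
split.
- move=> j l k n i li; rewrite /A_family (_ : A_set _ _ _ _ _ _ = set0) ?cards0 //.
  apply/setP => m; rewrite !inE; apply/negP => /and3P[/and3P[_ _ /forallP/(_ i)/eqP h] _ _].
  by rewrite -h in li.
- move=> l k n k0; rewrite /A_family (_ : A_set _ _ _ _ _ _ = set0) ?cards0 //.
  by apply/setP => m; rewrite !inE; apply/negP => /and3P[_ /eqP h _]; rewrite -h in k0.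
- move=> l k n n0; rewrite /A_family (_ : A_set _ _ _ _ _ _ = set0) ?cards0 //.
  apply/setP => m; rewrite !inE; apply/negP => /and3P[/and3P[_ /eqP h _] _ _].
  by rewrite -h in n0.
- by move=> j l k n hl _; apply: A_family_step.
- by move=> l k n _; apply: A_family_last.
- by move=> l n hl _; apply: A_family_alt.
Qed.

Lemma AbarE (r : nat) (l : 'I_r -> nat) (k n : nat) :
  (Abar l k n)%:Z = A_family n (\sum_(i < r) l i) 0 (fun i => (l i)%:Z) k%:Z n%:Z.
Proof.
rewrite /Abar /A_family; congr Posz; apply: eq_card => m; rewrite !inE /A_ok /A_mset.
have <- : (\sum_(p : Apart r n | ~~ p.2) m p)%N = nonover m.
  rewrite /nonover /msum big_mkcond; apply: eq_bigr => p _.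
  by case: (p.2); rewrite ?muln0 ?muln1.
rewrite !eqz_nat -!andbA; congr [&& _, _, _ & _]; last first.
  by rewrite andb_idr // => _; apply/forallP.
apply: eq_forallb => i; rewrite eqz_nat; congr (_ == _).
by rewrite /msum big_mkcond; apply: eq_bigr => p _; case: eqP; rewrite ?muln0 ?muln1.
Qed.

(** * Overpartitions with a given number of parts *)

(* The number of sequences [x_1, ..., x_s] of possibly overlined non-negative
   integers with [x_i - x_(i+1) >= chi x_(i+1)], sum [n], and [k] non-overlined
   terms: [a] is the last term, which is subtracted from all the others. *)
Fixpoint overpart (s : nat) (k n : int) : int :=
  if s is s'.+1 then
    \sum_(a < `|n|.+1) (overpart s' (k - 1) (n - (s * a)%:Z) +
                        overpart s' k (n - (s * a)%:Z - s'%:Z))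
  else ((k == 0) && (n == 0))%:Z.

Lemma overpart_k_lt0 s k n : k < 0 -> overpart s k n = 0.
Proof.
elim: s k n => [|s IHs] k n k0 /=; first by rewrite lt_eqF.
by rewrite big1 // => a _; rewrite !IHs //; lia.
Qed.

Lemma overpart_n_lt0 s k n : n < 0 -> overpart s k n = 0.
Proof.
elim: s k n => [|s IHs] k n n0 /=; first by rewrite andbC lt_eqF.
by rewrite big1 // => a _; rewrite !IHs //; lia.
Qed.

Lemma sum_ord_zero_tail (F : nat -> int) m p : (m <= p)%N ->
  (forall a, (m <= a)%N -> F a = 0) -> \sum_(a < m) F a = \sum_(a < p) F a.
Proof.
move=> mp z; rewrite (big_ord_widen _ _ mp) big_mkcond.
by apply: eq_bigr => a _; case: ltnP => // /z.
Qed.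

Lemma overpartS_widen s k n M : n < M%:Z ->
  overpart s.+1 k n =
    \sum_(a < M) (overpart s (k - 1) (n - (s.+1 * a)%:Z) +
                  overpart s k (n - (s.+1 * a)%:Z - s%:Z)).
Proof.
move=> nM.
pose F a : int := overpart s (k - 1) (n - (s.+1 * a)%:Z) +
                  overpart s k (n - (s.+1 * a)%:Z - s%:Z).
have z a : n < a%:Z -> F a = 0 by move=> na; rewrite /F !overpart_n_lt0 //; nia.
rewrite -[LHS]/(\sum_(a < `|n|.+1) F a) -[RHS]/(\sum_(a < M) F a).
case/orP: (leq_total `|n|.+1 M) => h; [|symmetry];
  by apply: sum_ord_zero_tail => // a ha; apply: z; lia.
Qed.

(** The three terms correspond to a positive last term (subtract 1 everywhere), a non-overlined last
    zero, and an overlined last zero, above which the other [s] terms are at least 1. *)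
Lemma overpartS s k n : overpart s.+1 k n =
  overpart s.+1 k (n - s.+1%:Z) + overpart s (k - 1) n + overpart s k (n - s%:Z).
Proof.
rewrite (@overpartS_widen s k n `|n|.+2); last by lia.
rewrite (@overpartS_widen s k (n - s.+1%:Z) `|n|.+1); last by lia.
rewrite big_ord_recl /= muln0 subr0 -[RHS]addrA [RHS]addrC.
congr (_ + _); apply: eq_bigr => a _.
by congr (overpart _ _ _ + overpart _ _ _); rewrite /= /bump /=; lia.
Qed.

(* Coefficientwise form of [X_s(d) - d X_(s-1)(d) = X_s(q d)] for
   [X_s(d) = \prod_(i < s) (d + q^i) / (1 - q^(i+1))]. *)
Lemma overpartS_shift s k n :
  overpart s.+1 k n = overpart s (k - 1) n + overpart s.+1 k (n - k).
Proof.
(* Negative [k] is set aside so that [n < 0] makes [n - k] negative too, which starts the inner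
   induction on [n]. *)
elim: s k n => [|s IHs] k n; have [k0|k0] := ltrP k 0;
  try by rewrite !overpart_k_lt0 //; lia.
  have [q] : exists q : nat, n < q%:Z by exists `|n|.+1; lia.
  elim: q n => [|q IHq] n nq; first by rewrite !overpart_n_lt0 //; lia.
  rewrite overpartS [in RHS]overpartS IHq; last by lia.
  have -> : n - k - 1%:Z = n - 1%:Z - k by lia.
  rewrite -!addrA [RHS]addrCA addrCA; congr (_ + _); rewrite /=; lia.
have [q] : exists q : nat, n < q%:Z by exists `|n|.+1; lia.
elim: q n => [|q IHq] n nq; first by rewrite !overpart_n_lt0 //; lia.
rewrite (overpartS _ k n) (overpartS _ k (n - k)) IHq; last by lia.
rewrite (IHs k (n - s.+1%:Z)).
(* What remains is a comparison of two expansions of [overpart s.+1 (k - 1) (n - 1)]. *)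
have := IHs (k - 1) (n - 1); have := overpartS s (k - 1) (n - 1).
have -> : n - 1 - s.+1%:Z = n - s.+2%:Z by lia.
have -> : n - 1 - s%:Z = n - s.+1%:Z by lia.
have -> : n - 1 - (k - 1) = n - k by lia.
have -> : n - k - s.+2%:Z = n - s.+2%:Z - k by lia.
have -> : n - k - s.+1%:Z = n - s.+1%:Z - k by lia.
move: (overpart _ _ _) (overpart _ _ _); lia.
Qed.

(** For a single term, the overlined and the non-overlined zero cancel; longer sequences inherit the
    vanishing through [overpartS]. Since [s <= M], the sum covers every possible [k]. *)
Lemma overpart_alt s n M : (s <= M)%N ->
  \sum_(k < M.+1) (-1) ^+ k * overpart s k%:Z n = ((s == 0%N) && (n == 0))%:Z.
Proof.
elim: s n M => [|s IHs] n M sM.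
  rewrite big_ord_recl expr0 mul1r big1 ?addr0 // => i _.
  by rewrite /= /bump /= mulr0.
case: M sM => // M sM.
have [q] : exists q : nat, n < q%:Z by exists `|n|.+1; lia.
elim: q n => [|q IHq] n nq.
  by rewrite big1 // => i _; rewrite overpart_n_lt0 ?mulr0 //; lia.
under eq_bigr do rewrite overpartS !mulrDr.
rewrite !big_split /= IHq ?IHs; [|lia|lia].
rewrite add0r big_ord_recl overpart_k_lt0 // mulr0 add0r.
under eq_bigr => i _.
  have -> : (lift ord0 i)%:Z - 1 = (i : nat)%:Z by rewrite lift0; lia.
  rewrite lift0 exprS mulN1r mulNr; over.
by rewrite sumrN IHs //; case: s {IHs sM IHq} => // ; rewrite subr0 addNr.
Qed.

Arguments overpart : simpl never.

(** * Colour words *)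

Lemma eq_bits r (c d : nat) : (c < 2 ^ r)%N -> (d < 2 ^ r)%N ->
  (forall j, (j < r)%N -> odd (c %/ 2 ^ j) = odd (d %/ 2 ^ j)) -> c = d.
Proof.
elim: r c d => [|r IHr] c d; first by rewrite expn0 !ltnS !leqn0 => /eqP -> /eqP ->.
rewrite expnS => hc hd h.
rewrite -(odd_double_half c) -(odd_double_half d).
have := h 0%N isT; rewrite expn0 !divn1 => ->; congr (_ + _.*2)%N.
apply: IHr; [by rewrite -divn2; lia | by rewrite -divn2; lia |].
by move=> j jr; rewrite -!divn2 -!divnMA -expnS; apply: h.
Qed.

Lemma prim_inj r : injective (fun c : 'I_(2 ^ r) => prim r c).
Proof.
move=> c d /setP e; apply/val_inj/(@eq_bits r); [exact: ltn_ord | exact: ltn_ord | move=> j jr].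
by have := e (Ordinal jr); rewrite !inE.
Qed.

Lemma prim_bij r : bijective (fun c : 'I_(2 ^ r) => prim r c).
Proof.
by apply: (inj_card_bij (@prim_inj r)); rewrite card_ord -cardsT -powersetT card_powerset cardsT card_ord.
Qed.

Lemma prim_eq0 r (c : 'I_(2 ^ r)) : (prim r c == set0) = (c == 0 :> nat).
Proof.
have p0 : prim r 0 = set0 by apply/setP => i; rewrite !inE div0n.
apply/eqP/eqP => [h|->//].
have z : (0 < 2 ^ r)%N by rewrite expn_gt0.
by have /(congr1 val) := @prim_inj r c (Ordinal z) (etrans h (esym p0)).
Qed.

Lemma ltn_bigmin (r x a : nat) (C : {set 'I_r}) :
  (x < \big[minn/a]_(i in C) (i : nat))%N =
  (x < a)%N && [forall i in C, (x < i)%N].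
Proof.
rewrite -big_andE; elim/big_rec2: _ => [|i y z _ IH]; first by rewrite andbT.
by rewrite leq_min IH andbCA.
Qed.

Lemma bigmax_set_eq (r : nat) (j : 'I_r) (C : {set 'I_r}) :
  (C != set0) && (\max_(i in C) (i : nat) == j)%N =
  (j \in C) && (C \subset [set i : 'I_r | (i <= j)%N]).
Proof.
apply/andP/andP => -[h1 h2]; split.
- have [i iC e] := eq_bigmax_cond (fun i : 'I_r => i : nat) (A := mem C) (etrans (card_gt0 C) h1).
  by rewrite (eqP h2) in e; rewrite (val_inj e).
- by apply/subsetP => i iC; rewrite inE -(eqP h2); apply: leq_bigmax_cond.
- by apply/set0Pn; exists j.
- rewrite eqn_leq (leq_bigmax_cond _ h1) andbT.
  by apply/bigmax_leqP => i iC; have := subsetP h2 i iC; rewrite inE.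
Qed.

Definition below (r j : nat) : {set 'I_r} := [set i : 'I_r | (i < j)%N].

(** By [prim_bij], a composite colour is a nonempty set of primary colours; removing its largest
    element [j] leaves an arbitrary set below [j]. *)
Lemma sum_zcol (r : nat) (j : 'I_r) (f : {set 'I_r} -> int) :
  \sum_(c : 'I_(2 ^ r) | (0 < c)%N && (zcol r c == j)) f (prim r c) =
  \sum_(M : {set 'I_r} | M \subset below r j) f (j |: M).
Proof.
transitivity (\sum_(C : {set 'I_r} | (C != set0) && (\max_(i in C) (i : nat) == j)%N) f C).
  rewrite (reindex (fun c : 'I_(2 ^ r) => prim r c)) /=; last first.
    exact: onW_bij (prim_bij r).
  by apply: eq_bigl => c; rewrite prim_eq0 -lt0n.
rewrite (reindex_onto (fun M => j |: M) (fun C => C :\ j)) /=; last first.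
  by move=> C; rewrite bigmax_set_eq => /andP[jC _]; rewrite setD1K.
apply: eq_bigl => M; rewrite bigmax_set_eq setU11 /=; apply/andP/idP.
  move=> [/subsetP h1 /eqP h2]; apply/subsetP => i iM; rewrite inE.
  have := h1 i; rewrite !inE iM orbT ltn_neqAle => /(_ isT) ->; rewrite andbT.
  by apply: contraTneq iM => /val_inj ->; rewrite -h2 !inE eqxx.
move=> /subsetP h; split.
  apply/subsetP => i; rewrite !inE => /orP[/eqP ->//|/h]; rewrite inE; exact: ltnW.
by apply/eqP/setU1K; apply/negP => /h; rewrite inE ltnn.
Qed.

Lemma sum_tuple_cons (T : finType) s (F : seq T -> int) :
  \sum_(t : s.+1.-tuple T) F t = \sum_x \sum_(t : s.-tuple T) F (x :: t).
Proof.
rewrite pair_bigA /=.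
rewrite (reindex (fun p : T * s.-tuple T => [tuple of p.1 :: p.2])) //=.
exists (fun t => (thead t, [tuple of behead t])) => [[x t] _|t _] /=.
  by congr pair; apply: val_inj.
by case/tupleP: t => x t; apply: val_inj.
Qed.

Lemma sum_tuple0 (T : finType) (F : seq T -> int) :
  \sum_(t : 0.-tuple T) F t = F [::].
Proof.
rewrite (bigD1 [tuple]) //= big1 ?addr0 // => t /eqP; case.
by rewrite [t]tuple0.
Qed.

(* Colour words are listed from the smallest part of the partition upwards. *)
Definition zhead (r : nat) (w : seq 'I_(2 ^ r)) : nat :=
  if w is c :: _ then zcol r c else 0%N.

(** The required difference above a non-overlined part of colour [c]. The default of [zhead] is
    harmless: for the empty word there is no part above. *)
Definition wgap (r : nat) (w : seq 'I_(2 ^ r)) (c : 'I_(2 ^ r)) : nat :=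
  ((wcol r c).-1 + (zhead w < vcol r c))%N.

(* The sum of the parts of the smallest partition with colour word [w] and no
   overlined part. *)
Fixpoint wweight (r : nat) (w : seq 'I_(2 ^ r)) : nat :=
  if w is c :: w' then (wweight w' + size w' * wgap w' c)%N else 0%N.

(** [M] holds primary colours of a part that is not in the word but still counts towards the content
    [l]. *)
Definition wok (r : nat) (l : 'I_r -> int) (w : seq 'I_(2 ^ r)) (M : {set 'I_r}) :=
  all (fun c : 'I_(2 ^ r) => 0 < c)%N w &&
  [forall i, (count (fun c : 'I_(2 ^ r) => i \in prim r c) w + (i \in M))%:Z == l i].

(** This is [delta] between the first colour of [w] and [M u_j]. Taking [j] as a natural number
    allows the extra colour [j = r]. *)
Definition zbelow (r j : nat) (w : seq 'I_(2 ^ r)) (M : {set 'I_r}) : bool :=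
  (zhead w < j)%N && [forall i in M, (zhead w < i)%N].

(** With all colours of [M] below [u_j], [#|M|] is [w - 1] for the colour [M u_j]; so each part of
    the word is lifted by the gap required above a non-overlined zero of that colour. *)
Definition Bterm (r j : nat) (l : 'I_r -> int) (k n : int) (w : seq 'I_(2 ^ r))
    (M : {set 'I_r}) : int :=
  if wok l w M then
    overpart (size w) k (n - (wweight w + size w * (#|M| + zbelow j w M))%:Z)
  else 0.

(* [B_family j l k n] counts the B-sequences of content [l + u_j], with [k + 1]
   non-overlined parts, whose last part is a non-overlined zero coloured by
   [M u_j] with all colours of [M] smaller than [u_j] (here [u_j] may be a new
   colour, larger than all the others). *)
Definition B_family (r L j : nat) (l : 'I_r -> int) (k n : int) : int :=
  \sum_(s < L.+1) \sum_(w : s.-tuple 'I_(2 ^ r))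
    \sum_(M : {set 'I_r} | M \subset below r j) Bterm j l k n w M.

(** * Recurrences for the families of colour words *)

Lemma wok_setU1 (r : nat) (j : 'I_r) (l : 'I_r -> int) w (M : {set 'I_r}) :
  j \notin M -> wok l w (j |: M) = wok (drop_colour l j) w M.
Proof.
move=> jM; rewrite /wok; congr (_ && _); apply: eq_forallb => i.
rewrite in_setU1 /drop_colour; case: (eqVneq i j) => [->|ij] /=.
  by rewrite (negbTE jM) addn0 eq_sym -subr_eq0 PoszD opprD addrA addrAC subr_eq0 eq_sym.
by rewrite subr0.
Qed.

Lemma wok_cons (r : nat) (j : 'I_r) (l : 'I_r -> int) w (c : 'I_(2 ^ r)) (M : {set 'I_r}) :
  (0 < c)%N -> prim r c = j |: M -> j \notin M ->
  wok l (c :: w) set0 = wok (drop_colour l j) w M.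
Proof.
move=> c0 e jM; rewrite -wok_setU1 // /wok /= c0 /= e; congr (_ && _).
by apply: eq_forallb => i; rewrite !inE addn0 addnC.
Qed.

Lemma zbelow_setU1 (r : nat) (j : 'I_r) w (M : {set 'I_r}) :
  zbelow j.+1 w (j |: M) = zbelow j w M.
Proof.
rewrite /zbelow ltnS; apply/andP/andP => [[h1 /forall_inP h2]|[h1 /forall_inP h2]].
  split; first by apply: h2; rewrite setU11.
  by apply/forall_inP => i iM; apply: h2; rewrite setU1r.
split; first exact: ltnW.
by apply/forall_inP => i /setU1P[->|/h2].
Qed.

(** The smallest colour of a nonempty [M] is already below [u_j], so it alone decides the
    comparison. *)
Lemma zbelow_neq0 (r : nat) (j : 'I_r) w (M : {set 'I_r}) :
  M != set0 -> M \subset below r j -> zbelow j.+1 w M = zbelow j w M.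
Proof.
case/set0Pn=> i iM /subsetP/(_ i iM); rewrite inE => ij.
rewrite /zbelow; case: forall_inP => [/(_ i iM) h|]; last by rewrite !andbF.
by rewrite !andbT ltnS; lia.
Qed.

Lemma ltn_vcol_setU1 (r : nat) (j : 'I_r) w (c : 'I_(2 ^ r)) (M : {set 'I_r}) :
  prim r c = j |: M -> (zhead w < vcol r c)%N = zbelow j w M.
Proof.
move=> e; rewrite /vcol ltn_bigmin e /zbelow.
apply/andP/andP => [[h1 /forall_inP h2]|[h1 /forall_inP h2]].
  split; first by apply: h2; rewrite setU11.
  by apply/forall_inP => i iM; apply: h2; rewrite setU1r.
split; first by rewrite (ltn_trans h1).
by apply/forall_inP => i /setU1P[->|/h2].
Qed.

(* Deleting the smallest part [c = M u_j] from a colour word leaves the data of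
   [B_family j]. *)
Lemma sum_peel (r : nat) (j : 'I_r) (l : 'I_r -> int) (w : seq 'I_(2 ^ r)) (G : nat -> int) :
  \sum_(c : 'I_(2 ^ r) | (0 < c)%N && (zcol r c == j))
    (if wok l (c :: w) set0 then G (wweight (c :: w)) else 0) =
  \sum_(M : {set 'I_r} | M \subset below r j)
    (if wok (drop_colour l j) w M
     then G (wweight w + size w * (#|M| + zbelow j w M))%N else 0).
Proof.
pose f C := if wok (drop_colour l j) w (C :\ j)
  then G (wweight w + size w * (#|C :\ j| + zbelow j w (C :\ j)))%N else 0.
transitivity (\sum_(c : 'I_(2 ^ r) | (0 < c)%N && (zcol r c == j)) f (prim r c)).
  apply: eq_bigr => c /andP[c0 zc].
  have := bigmax_set_eq j (prim r c); rewrite [X in _ && X]zc prim_eq0 -lt0n c0 /=.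
  move=> /esym/andP[jc _].
  have e : prim r c = j |: (prim r c :\ j) by rewrite setD1K.
  have jn : j \notin prim r c :\ j by rewrite !inE eqxx.
  rewrite (wok_cons _ _ c0 e jn) /f /= /wgap (ltn_vcol_setU1 _ e).
  by rewrite /wcol (cardsD1 j (prim r c)) jc.
rewrite sum_zcol; apply: eq_bigr => M /subsetP hM.
have jM : j \notin M by apply/negP => /hM; rewrite inE ltnn.
by rewrite /f setU1K.
Qed.

Lemma sum_below_recr (r : nat) (j : 'I_r) (f : {set 'I_r} -> int) :
  \sum_(M : {set 'I_r} | M \subset below r j.+1) f M =
  \sum_(M : {set 'I_r} | M \subset below r j) f M +
  \sum_(M : {set 'I_r} | M \subset below r j) f (j |: M).
Proof.
rewrite (bigID (fun M : {set 'I_r} => j \in M)) /= addrC; congr (_ + _).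
  apply: eq_bigl => M; apply/andP/subsetP => [[/subsetP h jM] i iM|h].
    have := h i iM; rewrite !inE ltnS leq_eqVlt => /orP[/eqP/val_inj ij|//].
    by rewrite -ij iM in jM.
  split; last by apply/negP => /h; rewrite inE ltnn.
  by apply/subsetP => i /h; rewrite !inE => /leqW.
rewrite (reindex_onto (fun M => j |: M) (fun M => M :\ j)) /=; last first.
  by move=> M /andP[_ jM]; rewrite setD1K.
apply: eq_bigl => M; rewrite setU11 andbT; apply/andP/subsetP => [[/subsetP h /eqP e] i iM|h].
  have := h i; rewrite !inE iM orbT ltnS leq_eqVlt => /(_ isT)/orP[/eqP/val_inj ij|//].
  by move: iM; rewrite -e ij !inE eqxx.
split; first by apply/subsetP => i; rewrite !inE => /orP[/eqP ->//|/h]; rewrite inE => /leqW.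
by apply/eqP/setU1K; apply/negP => /h; rewrite inE ltnn.
Qed.

Lemma wok_size (r : nat) (l : 'I_r -> int) w M :
  wok l w M -> (size w)%:Z <= \sum_i l i.
Proof.
case/andP=> pos /forallP h; rewrite -(eq_bigr _ (fun i _ => eqP (h i))).
rewrite -(big_morph _ PoszD (erefl _)) lez_nat big_split /=.
apply: leq_trans (leq_addr _ _); elim: w pos {h} => //= c w IHw /andP[c0 /IHw h].
rewrite big_split /=; apply: (leq_add (m1 := 1)) => //.
have : prim r c != set0 by rewrite prim_eq0 -lt0n.
by case/set0Pn=> i ic; rewrite (bigD1 i) //= ic.
Qed.

(** Here [a] is the overline indicator of the zero being removed, which lifts every part above it by
    [a]. On the right, words of length [L] contribute nothing, since dropping [u_j] leaves a total
    below [L]. *)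
Lemma sum_words_peel (r L : nat) (j : 'I_r) (l : 'I_r -> int) (k n : int) (a : nat) :
  \sum_i l i <= L%:Z ->
  \sum_(s < L) \sum_(w : s.-tuple 'I_(2 ^ r))
    \sum_(c : 'I_(2 ^ r) | (0 < c)%N && (zcol r c == j))
      (if wok l (c :: w) set0
       then overpart s k (n - (a * s)%:Z - (wweight (c :: w))%:Z) else 0) =
  \sum_(s < L.+1) \sum_(w : s.-tuple 'I_(2 ^ r))
    \sum_(M : {set 'I_r} | M \subset below r j)
      Bterm j (drop_colour l j) k (n - (a * size w)%:Z) w M.
Proof.
move=> hl; rewrite [RHS]big_ord_recr /= [X in _ + X]big1 ?addr0; last first.
  move=> w _; rewrite big1 // => M _; rewrite /Bterm; case: ifP => // /wok_size.
  rewrite sum_drop_colour size_tuple lerBrDr => /le_trans/(_ hl).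
  by rewrite -PoszD lez_nat addn1 ltnn.
apply: eq_bigr => s _; apply: eq_bigr => w _.
rewrite (sum_peel j l w (fun x => overpart s k (n - (a * s)%:Z - x%:Z))).
by apply: eq_bigr => M _; rewrite /Bterm size_tuple.
Qed.

Lemma B_family_step (r L : nat) (j : 'I_r) (l : 'I_r -> int) k n :
  \sum_i l i <= L%:Z ->
  B_family L j l k n = B_family L j.+1 l k n
    + B_family L j (drop_colour l j) (k - 1) n.
Proof.
move=> hl.
(* For a set containing [u_j], that colour is moved into [drop_colour]; the cardinality falls by
   one, whence the correction [1 * size w]. *)
have E1 : B_family L j.+1 l k n =
  \sum_(s < L.+1) \sum_(w : s.-tuple 'I_(2 ^ r))
     \sum_(M : {set 'I_r} | M \subset below r j) Bterm j.+1 l k n w M +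
  \sum_(s < L.+1) \sum_(w : s.-tuple 'I_(2 ^ r))
    \sum_(M : {set 'I_r} | M \subset below r j)
      Bterm j (drop_colour l j) k (n - (1 * size w)%:Z) w M.
  rewrite /B_family -big_split; apply: eq_bigr => s _ /=.
  rewrite -big_split; apply: eq_bigr => w _ /=.
  rewrite sum_below_recr; congr (_ + _); apply: eq_bigr => M /subsetP hM.
  have jM : j \notin M by apply/negP => /hM; rewrite inE ltnn.
  rewrite /Bterm wok_setU1 // zbelow_setU1 cardsU1 jM; case: ifP => // _.
  by congr overpart; rewrite size_tuple; lia.
(* Passing from [j] to [j.+1] changes [zbelow] only for the empty [M]. *)
have E2 : B_family L j l k n =
  \sum_(s < L.+1) \sum_(w : s.-tuple 'I_(2 ^ r))
     \sum_(M : {set 'I_r} | M \subset below r j) Bterm j.+1 l k n w M +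
  \sum_(s < L.+1) \sum_(w : s.-tuple 'I_(2 ^ r))
     (Bterm j l k n w set0 - Bterm j.+1 l k n w set0).
  rewrite /B_family -big_split; apply: eq_bigr => s _ /=.
  rewrite -big_split; apply: eq_bigr => w _ /=.
  rewrite (bigD1 set0) ?sub0set //= [X in _ = X + _](bigD1 set0) ?sub0set //=.
  rewrite [RHS]addrC [RHS]addrA subrK; congr (_ + _).
  by apply: eq_bigr => M /andP[hM M0]; rewrite /Bterm zbelow_neq0.
rewrite E2 E1 -!addrA; congr (_ + _).
rewrite big_ord_recl /=.
rewrite (sum_tuple0 (fun w => Bterm j l k n w set0 - Bterm j.+1 l k n w set0)) {1 2}/Bterm /= !mul0n subrr add0r.
(* The difference counts words whose first part is a zero with largest colour [u_j], non-overlined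
   in the first sum and overlined in the second. *)
transitivity (\sum_(s < L) \sum_(w : s.-tuple 'I_(2 ^ r))
    \sum_(c : 'I_(2 ^ r) | (0 < c)%N && (zcol r c == j))
      (if wok l (c :: w) set0
       then overpart s (k - 1) (n - (0 * s)%:Z - (wweight (c :: w))%:Z) else 0) +
  \sum_(s < L) \sum_(w : s.-tuple 'I_(2 ^ r))
    \sum_(c : 'I_(2 ^ r) | (0 < c)%N && (zcol r c == j))
      (if wok l (c :: w) set0
       then overpart s k (n - (1 * s)%:Z - (wweight (c :: w))%:Z) else 0)); last first.
  rewrite !sum_words_peel // addrC; congr (_ + _).
  by do 3!apply: eq_bigr => ? _; rewrite mul0n subr0.
rewrite -big_split; apply: eq_bigr => s _ /=.
rewrite (sum_tuple_cons _ (fun w => Bterm j l k n w set0 - Bterm j.+1 l k n w set0)).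
rewrite exchange_big /= -big_split; apply: eq_bigr => w _ /=.
rewrite -big_split [RHS]big_mkcond; apply: eq_bigr => c _ /=.
rewrite /Bterm; case: (boolP (wok l (c :: w) set0)) => [ok|_]; last by rewrite subrr ?addr0 if_same.
have c0 : (0 < c)%N by case/andP: ok => /andP[].
have fe : [forall i in set0 : {set 'I_r}, (zcol r c < i)%N].
  by apply/forall_inP => i; rewrite inE.
rewrite c0 /zbelow /= fe !andbT cards0 !add0n size_tuple ltnS.
(* Only [zcol r c = j] leaves a difference: [zbelow] then holds for [j.+1] and fails for [j]. *)
case: ltngtP => [_|_|_]; rewrite ?subrr //.
rewrite muln0 addn0 muln1 mul0n subr0 mul1n overpartS.
set W := (wweight w + _)%N.
have -> : n - (W + s.+1)%:Z = n - W%:Z - s.+1%:Z by lia.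
have -> : n - s%:Z - W%:Z = n - W%:Z - s%:Z by lia.
lia.
Qed.

Definition Bword (r : nat) (l : 'I_r -> int) (k n : int) (w : seq 'I_(2 ^ r)) : int :=
  if wok l w set0 then overpart (size w) k (n - (wweight w)%:Z) else 0.

Lemma B_family0 (r L : nat) (l : 'I_r -> int) k n :
  B_family L 0 l k n =
  \sum_(s < L.+1) \sum_(w : s.-tuple 'I_(2 ^ r)) Bword l k n w.
Proof.
apply: eq_bigr => s _; apply: eq_bigr => w _.
rewrite (big_pred1 set0) => [|M].
  by rewrite /Bterm /zbelow ltn0 cards0 muln0 addn0.
apply/subsetP/eqP => [h|-> i]; last by rewrite inE.
by apply/setP => i; rewrite inE; apply/negP => /h; rewrite inE.
Qed.

Lemma sum_zcol_split (r : nat) (f : 'I_(2 ^ r) -> int) :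
  \sum_(c : 'I_(2 ^ r) | (0 < c)%N) f c =
  \sum_(j < r) \sum_(c : 'I_(2 ^ r) | (0 < c)%N && (zcol r c == j)) f c.
Proof.
rewrite (exchange_big_dep (fun c : 'I_(2 ^ r) => 0 < c)%N) /=; last by move=> ? ? _ /andP[].
apply: eq_bigr => c c0; rewrite c0 /=.
have : prim r c != set0 by rewrite prim_eq0 -lt0n.
rewrite -card_gt0 => /(eq_bigmax_cond (fun i : 'I_r => i : nat))[j jc zc].
by rewrite (big_pred1 j) // => i; rewrite /= [zcol r c]zc eq_sym.
Qed.

(** Telescoping reduces this to a recurrence that holds word by word: summed over [j], the peeled
    terms run over all colours of the smallest part, and [overpartS_shift] applies to each word. *)
Lemma B_family_last (r L : nat) (l : 'I_r -> int) k n :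
  \sum_i l i <= L%:Z -> B_family L r l k n = B_family L 0 l k (n - k).
Proof.
move=> hl.
have := peel_telescope (f := @B_family r L) (fun j => B_family_step j k n hl).
suff -> : B_family L 0 l k n = B_family L 0 l k (n - k) +
    \sum_(j < r) B_family L j (drop_colour l j) (k - 1) n.
  by move/addIr.
have -> : \sum_(j < r) B_family L j (drop_colour l j) (k - 1) n =
    \sum_(s < L) \sum_(w : s.-tuple 'I_(2 ^ r)) \sum_(c : 'I_(2 ^ r) | (0 < c)%N)
      (if wok l (c :: w) set0
       then overpart s (k - 1) (n - (wweight (c :: w))%:Z) else 0).
  under [RHS]eq_bigr do under eq_bigr do rewrite sum_zcol_split.
  under [RHS]eq_bigr do rewrite exchange_big.
  rewrite [RHS]exchange_big; apply: eq_bigr => j _ /=.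
  transitivity (\sum_(s < L) \sum_(w : s.-tuple 'I_(2 ^ r))
      \sum_(c : 'I_(2 ^ r) | (0 < c)%N && (zcol r c == j))
        (if wok l (c :: w) set0
         then overpart s (k - 1) (n - (0 * s)%:Z - (wweight (c :: w))%:Z) else 0)).
    by rewrite sum_words_peel //; do 3!apply: eq_bigr => ? _; rewrite mul0n subr0.
  by do 3!apply: eq_bigr => ? _; rewrite mul0n subr0.
rewrite !B_family0 !(big_ord_recl L) /= !sum_tuple0 -addrA; congr (_ + _).
  (* The empty word contributes only at [k = 0], where [n - k = n]. *)
  rewrite /Bword; case: ifP => // _; rewrite /overpart /=.
  by case: (eqVneq k 0) => [->|]; rewrite ?subr0.
rewrite -big_split; apply: eq_bigr => s _ /=.
rewrite !sum_tuple_cons exchange_big /= [X in X + _]exchange_big /= -big_split.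
apply: eq_bigr => w _ /=; rewrite [X in _ + X]big_mkcond -big_split; apply: eq_bigr => c _ /=.
rewrite /Bword; case: (boolP (wok l (c :: w) set0)) => [ok|_]; last by rewrite if_same addr0.
have c0 : (0 < c)%N by case/andP: ok => /andP[].
by rewrite c0 /= size_tuple overpartS_shift addrC [n - k - _]addrAC.
Qed.

(** Each nonempty word cancels on its own by [overpart_alt]; the empty word gives the right-hand
    side. *)
Lemma B_family_alt (r L : nat) (l : 'I_r -> int) n :
  \sum_(k < L.+1) (-1) ^+ k * B_family L 0 l k%:Z n
    = ((n == 0) && [forall i, l i == 0])%:Z.
Proof.
under eq_bigr do rewrite B_family0 mulr_sumr.
rewrite exchange_big /=.
have E s : (s <= L)%N ->
    \sum_(k < L.+1) (-1) ^+ k * \sum_(w : s.-tuple 'I_(2 ^ r)) Bword l k%:Z n w =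
    \sum_(w : s.-tuple 'I_(2 ^ r)) (if wok l w set0
      then ((s == 0%N) && (n - (wweight w)%:Z == 0))%:Z else 0).
  move=> sL; under eq_bigr do rewrite mulr_sumr.
  rewrite exchange_big; apply: eq_bigr => w _ /=; rewrite /Bword size_tuple.
  case: ifP => _; last by rewrite big1 // => k _; rewrite mulr0.
  by rewrite overpart_alt.
rewrite (eq_bigr _ (fun (s : 'I_L.+1) _ => E s (ltn_ord s))) big_ord_recl /=.
rewrite (sum_tuple0 (fun w => if wok l w set0 then (n - (wweight w)%:Z == 0)%:Z else 0)).
rewrite [X in _ + X]big1 => [|s _]; last by rewrite big1 // => w _; rewrite if_same.
rewrite addr0 /= subr0 /wok /= andbC.
have -> : [forall i, (0 + (i \in (set0 : {set 'I_r})))%:Z == l i] = [forall i, l i == 0].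
  by apply: eq_forallb => i; rewrite inE eq_sym.
by case: [forall i, _].
Qed.

Lemma B_zero_peeling (r N L : nat) : zero_peeling L N%:Z (@B_family r L).
Proof.
have Z l k n (w : seq 'I_(2 ^ r)) : k < 0 \/ n < 0 -> Bword l k n w = 0.
  rewrite /Bword; case: ifP => // _ [h|h]; first exact: overpart_k_lt0.
  by apply: overpart_n_lt0; lia.
split.
- move=> j l k n i li; do 3!(apply: big1 => ? _).
  rewrite /Bterm; case: ifP => // /andP[_ /forallP/(_ i)/eqP h].
  by rewrite -h in li.
- by move=> l k n k0; rewrite B_family0; do 2!(apply: big1 => ? _); apply: Z; left.
- by move=> l k n n0; rewrite B_family0; do 2!(apply: big1 => ? _); apply: Z; right.
- by move=> j l k n hl _; apply: B_family_step.
- by move=> l k n hl _; apply: B_family_last.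
- by move=> l n _ _; apply: B_family_alt.
Qed.

(** * From sequences with difference conditions to colour words *)

Definition Bhead_ge (r N : nat) (b : nat) (t : seq (Bpart r N)) : bool :=
  if t is p :: _ then (b <= p.1.1)%N else true.

(** Sequences are read from the smallest part, hence the swapped [Bdiff]. The colour content depends
    on the colour word only and is imposed later. *)
Definition Bseq (r N : nat) (k n : int) (t : seq (Bpart r N)) : bool :=
  [&& all (fun p : Bpart r N => 0 < p.1.2)%N t,
      (\sum_(p <- t) p.1.1)%N%:Z == n,
      (count (fun p : Bpart r N => ~~ p.2) t)%:Z == k &
      sorted (fun p q => Bdiff q p) t].

Lemma Bseq_cons (r N : nat) (k n : int) (p : Bpart r N) t :
  Bseq k n (p :: t) =
  [&& (0 < p.1.2)%N, Bseq (k - (~~ p.2)%:Z) (n - p.1.1%:Z) t &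
      Bhead_ge (p.1.1 + p.2 + wgap [seq q.1.2 | q : Bpart r N <- t] p.1.2) t].
Proof.
have addE (a b : nat) (c : int) : ((a + b)%N%:Z == c) = (b%:Z == c - a%:Z).
  by apply/eqP/eqP; lia.
rewrite /Bseq /= big_cons !addE -!andbA; case: (boolP (0 < p.1.2)%N) => //= p0.
do 3!congr (_ && _); case: t => //= q t; rewrite andbC; congr (_ && _).
(* A nonzero colour has [w >= 1], so the predecessor in [wgap] is a true subtraction. *)
have : (0 < wcol r p.1.2)%N by rewrite card_gt0 prim_eq0 -lt0n.
rewrite /Bdiff /wgap /deltac /chi /=.
move: (wcol r p.1.2) (zcol r q.1.2 < vcol r p.1.2)%N => W d W0.
by case: d; case: (p.2); apply/idP/idP; lia.
Qed.

Lemma sum_Bpart (r N : nat) (f : nat -> 'I_(2 ^ r) -> bool -> int) :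
  \sum_(p : Bpart r N) f p.1.1 p.1.2 p.2 =
  \sum_(c : 'I_(2 ^ r)) \sum_(a < N.+1) (f a c false + f a c true).
Proof.
rewrite exchange_big /= pair_bigA /=.
rewrite -(pair_bigA _ (fun (x : 'I_N.+1 * 'I_(2 ^ r)) b => f x.1 x.2 b)) /=.
by apply: eq_bigr => x _; rewrite big_bool addrC.
Qed.

(** If the last term is at least [b], then [b] can be subtracted from all [s.+1] terms. *)
Lemma overpart_sum_ge (N s b : nat) (k X : int) : X <= N%:Z ->
  \sum_(a < N.+1) (if (b <= a)%N then
     overpart s (k - 1) (X - (s.+1 * a)%:Z) +
     overpart s k (X - (s.+1 * a)%:Z - s%:Z) else 0) =
  overpart s.+1 k (X - (s.+1 * b)%:Z).
Proof.
move=> hX; have [bN|bN] := leqP b N; last first.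
  rewrite overpart_n_lt0; last by nia.
  by rewrite big1 // => a _; case: ifP => //; have := ltn_ord a; lia.
rewrite (@overpartS_widen _ _ _ (N.+1 - b)); last by nia.
pose F a := overpart s (k - 1) (X - (s.+1 * a)%:Z) +
     overpart s k (X - (s.+1 * a)%:Z - s%:Z).
rewrite -(big_mkord xpredT (fun a => if (b <= a)%N then F a else 0)).
rewrite (big_cat_nat (leq0n b) (leqW bN)) /=.
rewrite big_nat_cond big1 ?add0r; last by move=> a; case: leqP => //; lia.
rewrite -{1}(add0n b) big_addn big_mkord; apply: eq_bigr => a _.
rewrite leq_addl /F; congr (overpart _ _ _ + overpart _ _ _); lia.
Qed.

(* [b] may depend on the colour word: this is what the induction needs, the
   bound on the remaining parts being the gap above the part just removed. *)
Lemma sum_Bseq (r N s : nat) (F : seq 'I_(2 ^ r) -> int) (b : seq 'I_(2 ^ r) -> nat)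
    (k n : int) : n <= N%:Z ->
  \sum_(t : s.-tuple (Bpart r N))
    (let w := [seq q.1.2 | q : Bpart r N <- t] in
     if Bseq k n t && Bhead_ge (b w) t then F w else 0) =
  \sum_(w : s.-tuple 'I_(2 ^ r))
    (if all (fun c : 'I_(2 ^ r) => 0 < c)%N w
     then F w * overpart s k (n - (s * b w + wweight w)%:Z) else 0).
Proof.
elim: s F b k n => [|s IHs] F b k n hn.
  rewrite (sum_tuple0 (fun t : seq (Bpart r N) =>
    let w := [seq q.1.2 | q : Bpart r N <- t] in
    if Bseq k n t && Bhead_ge (b w) t then F w else 0)).
  rewrite (sum_tuple0 (fun w => if all (fun c : 'I_(2 ^ r) => 0 < c)%N w
     then F w * overpart 0 k (n - (0 * b w + wweight w)%:Z) else 0)) /=.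
  rewrite /Bseq /= big_nil /overpart mul0n /= subr0 !andbT.
  rewrite [0 == n]eq_sym [0 == k]eq_sym andbC.
  by case: (_ && _); rewrite ?mulr1 ?mulr0.
rewrite (sum_tuple_cons s (fun t : seq (Bpart r N) =>
    let w := [seq q.1.2 | q : Bpart r N <- t] in
    if Bseq k n t && Bhead_ge (b w) t then F w else 0)).
(* The contribution of a smallest part of value [a], colour [c] and overline [o]: the parts above it
   must reach [a + o + wgap w c]. *)
pose f (a : nat) (c : 'I_(2 ^ r)) (o : bool) : int := if (0 < c)%N then
  \sum_(w : s.-tuple 'I_(2 ^ r))
    (if all (fun c : 'I_(2 ^ r) => 0 < c)%N w
     then (if (b (c :: w) <= a)%N then F (c :: w) else 0) *
       overpart s (k - (~~ o)%:Z) (n - a%:Z - (s * (a + o + wgap w c) + wweight w)%:Z) else 0)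
  else 0.
transitivity (\sum_(p : Bpart r N) f p.1.1 p.1.2 p.2).
  apply: eq_bigr => p _; rewrite /f; case: (boolP (0 < p.1.2)%N) => p0; last first.
    by rewrite big1 // => t _; rewrite /= Bseq_cons (negbTE p0).
  have := IHs (fun w => if (b (p.1.2 :: w) <= p.1.1)%N then F (p.1.2 :: w) else 0)
    (fun w => p.1.1 + p.2 + wgap w p.1.2)%N (k - (~~ p.2)%:Z) (n - p.1.1%:Z).
  move=> <-; last by lia.
  apply: eq_bigr => t _; rewrite /= Bseq_cons p0 /=.
  by case: (Bseq _ _ _) => //=; case: (Bhead_ge _ t) => //=.
rewrite sum_Bpart (sum_tuple_cons s (fun w =>
   if all (fun c : 'I_(2 ^ r) => 0 < c)%N w
     then F w * overpart s.+1 k (n - (s.+1 * b w + wweight w)%:Z) else 0)).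
apply: eq_bigr => c _; rewrite /f /=.
case: (boolP (0 < c)%N) => c0; last by rewrite !big1 // => ? _; rewrite addr0.
under eq_bigr do rewrite -big_split.
rewrite exchange_big; apply: eq_bigr => w _ /=.
case: ifP => _; last by rewrite big1.
have hX : n - (wweight w + s * wgap w c)%:Z <= N%:Z by lia.
rewrite size_tuple.
have -> : n - (s.+1 * b (c :: w) + (wweight w + s * wgap w c))%:Z =
  n - (wweight w + s * wgap w c)%:Z - (s.+1 * b (c :: w))%:Z by lia.
rewrite -(overpart_sum_ge _ _ _ hX) mulr_sumr; apply: eq_bigr => a _.
case: ifP => _; last by rewrite !mul0r addr0 mulr0.
rewrite -mulrDr subr0; congr (_ * (overpart _ _ _ + overpart _ _ _)); nia.
Qed.

Lemma BbarE (r : nat) (l : 'I_r -> nat) (k n : nat) :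
  (Bbar l k n)%:Z = B_family (\sum_(i < r) l i) 0 (fun i => (l i)%:Z) k%:Z n%:Z.
Proof.
rewrite B_family0 /Bbar (big_morph _ PoszD (erefl _)); apply: eq_bigr => s _.
(* The content condition enters as a 0-1 weight on the colour word. *)
pose F w : int := [forall i, count (fun c : 'I_(2 ^ r) => i \in prim r c) w == l i]%:Z.
have H := @sum_Bseq r n s F (fun=> 0%N) k%:Z n%:Z (lexx _).
have revI : involutive (fun t : s.-tuple (Bpart r n) => [tuple of rev t]).
  by move=> t; apply: val_inj; exact: revK.
transitivity (\sum_(t : s.-tuple (Bpart r n))
    (let w := [seq q.1.2 | q : Bpart r n <- t] in
     if Bseq k%:Z n%:Z t && Bhead_ge 0 t then F w else 0)).
  rewrite -sum1_card (big_morph _ PoszD (erefl _)) big_mkcond /=.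
  rewrite (reindex_inj (inv_inj revI)); apply: eq_bigr => t _ /=.
  have -> : Bhead_ge 0 t by case: (tval t).
  rewrite inE /B_ok /Bseq /F /= all_rev count_rev rev_sorted andbT !eqz_nat.
  rewrite (perm_big t) ?perm_rev //=.
  have -> : [forall i, count (fun p : Bpart r n => i \in prim r p.1.2) (rev t) == l i] =
      [forall i, count (fun c : 'I_(2 ^ r) => i \in prim r c)
        [seq q.1.2 | q : Bpart r n <- t] == l i].
    by apply: eq_forallb => i; rewrite count_rev count_map.
  by case: [forall i, _]; rewrite /= ?andbF //; case: ifP.
rewrite H; apply: eq_bigr => w _; rewrite /Bword /wok muln0 add0n size_tuple.
case: all => //=; rewrite /F.
have -> : [forall i, (count (fun c : 'I_(2 ^ r) => i \in prim r c) w +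
      (i \in (set0 : {set 'I_r})))%:Z == (l i)%:Z] =
    [forall i, count (fun c : 'I_(2 ^ r) => i \in prim r c) w == l i].
  by apply: eq_forallb => i; rewrite inE addn0 eqz_nat.
by case: [forall i, _]; rewrite ?mul1r ?mul0r.
Qed.

Theorem theorem2p7 (r : nat) (hr : (1 <= r)%N) (l : 'I_r -> nat) (k n : nat) :
  Abar l k n = Bbar l k n.
Proof.
apply/eqP; rewrite -eqz_nat AbarE BbarE; apply/eqP.
apply: (zero_peeling_unique _ (@A_zero_peeling r n _) (@B_zero_peeling r n _)) => //.
by rewrite -(big_morph _ PoszD (erefl _)).
Qed.
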